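(* Let $\mu_1,\dots,\mu_q$ be probability measures on $\mathbb{R}$, absolutely continuous with respect to Lebesgue measure, with densities $h_1,\dots,h_q$. Assume that the common support $$I=\bigcap_{i=1}^q\mathrm{supp}(\mu_i)$$ is a finite union of closed intervals. Suppose that each $h_i$ has at most finitely many singularities or zeros, located at points $s\in S\subset I$, and that near each $s$, $$h_i(x)\asymp|x-s|^{\alpha_i(s)},$$ with $-1<\alpha_i(s)<0$ for singularities and $\alpha_i(s)>0$ for zeros (and $\alpha_i(s)=0$ if $s$ is neither a singularity nor a zero of $h_i$). Define $$\overline\alpha=\min_{s\in S}\left\{\frac1q\sum_{i=1}^q\alpha_i(s)\right\}.$$ Then: (1) if $S=\emptyset$ or $\overline\alpha\ge0$, then $C_q(\mu_1,\dots,\mu_q)=1$; (2) if $\overline\alpha<0$, then $$C_q(\mu_1,\dots,\mu_q)=\begin{cases}1&\text{if } q<-\dfrac1{\overline\alpha},\\[6pt]\dfrac{q(1+\overline\alpha)}{q-1}&\text{otherwise.}\end{cases}$$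
   Context: Here $q\ge2$ is an integer. The co-dimension of $\mu_1,\dots,\mu_q$ is, if the limit exists, $$C_q(\mu_1,\dots,\mu_q):=\lim_{r\to0}\frac{\log\int\prod_{i=2}^q\mu_i(B_r(x))\,d\mu_1(x)}{(q-1)\log r},$$ where $B_r(x)$ is the ball of radius $r$ centred at $x$. The notation $f\asymp g$ means that $f/g$ is bounded above and below by positive constants.
   Formalization: The common support I is taken to be a nonempty finite union of nondegenerate closed intervals, and each density h_i is assumed essentially bounded away from every neighbourhood of S, also at infinity; without these the claim can fail. *)

(* Defs.v *)
From HB Require Import structures.
From mathcomp Require Import all_boot all_order all_algebra.
From mathcomp Require Import all_classical all_reals all_analysis.
Set Implicit Arguments.
Unset Strict Implicit.
Unset Printing Implicit Defensive.
Import Order.TTheory GRing.Theory Num.Theory.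
Import numFieldNormedType.Exports.
Local Open Scope classical_set_scope.
Local Open Scope ring_scope.

Definition is_density (R : realType) (mu : probability (measurableTypeR R) R)
    (h : R -> R) : Prop :=
  [/\ measurable_fun [set: measurableTypeR R] h,
      forall x, 0 <= h x &
      forall A : set (measurableTypeR R), measurable A ->
        mu A = (\int[lebesgue_measure]_(x in A) (h x)%:E)%E].

Definition supp (R : realType) (mu : probability (measurableTypeR R) R) :
    set R :=
  [set x | forall U : set R, open U -> U x -> (0 < mu U)%E].

(* The measures mu_1, ..., mu_q are indexed from 0 by 'I_q, so that mu_1 is the
   one of index 0. *)
Definition codim_integral (R : realType) (q : nat) (hq : (2 <= q)%N)
    (mu : 'I_q -> probability (measurableTypeR R) R) (r : R) : \bar R :=
  (\int[mu (Ordinal (ltnW hq))]_x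
     \prod_(i < q | (0 < i)%N) mu i (ball (x : R) r))%E.

(* The co-dimension exists and equals c. The logarithm is the extended one
   (lne 0 = -oo), so a vanishing integral does not yield a spurious finite
   value. *)
Definition is_codim (R : realType) (q : nat) (hq : (2 <= q)%N)
    (mu : 'I_q -> probability (measurableTypeR R) R) (c : R) : Prop :=
  (lne (codim_integral hq mu r) / ((q%:R - 1) * ln r)%:E)%E
    @[r --> 0^'+] --> c%:E.

(* Almost everywhere, because densities are only determined up to null sets.
   This also disposes of the points where g vanishes, when they form a null
   set. *)
Definition asymp_on (R : realType) (A : set R) (f g : R -> R) : Prop :=
  exists c C : R, [/\ 0 < c, 0 < C &
    {ae (@lebesgue_measure R), forall x : R, A x -> c <= f x / g x <= C}].

(* Points off the support are excluded because h vanishes a.e. there; the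
   asymptotics is thus one-sided at an endpoint of the support. *)
Definition power_law_near (R : realType)
    (mu : probability (measurableTypeR R) R) (h : R -> R) (s a : R) : Prop :=
  exists2 d : R, 0 < d &
    asymp_on (supp mu `&` ball s d) h (fun x => `|x - s| `^ a).

(* h has no singularity outside S, nor at infinity: it is essentially bounded
   away from S. For a boundedly supported h this amounts to h being essentially
   bounded near every point outside S. *)
Definition no_singularity_off (R : realType) (S : seq R) (h : R -> R) : Prop :=
  forall d : R, 0 < d -> exists M : R,
    {ae (@lebesgue_measure R), forall x : R,
      (forall s, s \in S -> d <= `|x - s|) -> h x <= M}.

(* The intervals are nondegenerate and may be unbounded; the union is not
   empty. *)
Definition finite_union_closed_itv (R : realType) (I : set R) : Prop :=
  exists Js : seq (interval R),
    [/\ Js != [::],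
        forall J, J \in Js -> closed [set` J] /\ interior [set` J] !=set0 &
        I = \bigcup_(J in [set` Js]) [set` J]].

Definition alpha_mean (R : realType) (q : nat) (alpha : 'I_q -> R -> R)
    (s : R) : R :=
  q%:R^-1 * \sum_(i < q) alpha i s.

(* The seed is one of the values over which the minimum is taken, so this is
   the minimum as soon as S is not empty; it is meaningless for S = [::]. *)
Definition alpha_bar (R : realType) (q : nat) (alpha : 'I_q -> R -> R)
    (S : seq R) : R :=
  \big[Num.min / alpha_mean alpha (head 0 S)]_(s <- S) alpha_mean alpha s.

(* Main.v *)
Require Import Defs.
From HB Require Import structures.
From mathcomp Require Import all_boot all_order all_algebra.
From mathcomp Require Import all_classical all_reals all_analysis.
From mathcomp Require Import measurable_realfun ring lra.
Import Order.TTheory GRing.Theory Num.Theory.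
Import numFieldNormedType.Exports.
Local Open Scope classical_set_scope.
Local Open Scope ring_scope.

(** Write [F r] for the integral of the product of the [mu_i (ball x r)], [i > 1],
    against [mu_1], [A s] for the sum of the exponents [alpha_i s], and [e] for
    the minimum of [q - 1] and of the [q + A s], [s] in [S]. Then
    [c r^e <= F r <= C r^(e - eps)] for every [eps > 0] and all small [r], and
    dividing logarithms yields [e / (q - 1)].

    For the upper bound, far from [S] the densities are bounded and each factor
    is [O(r)]. Near [s], with [w = max |x - s| r], each factor is
    [O(r w^(alpha_i s))], whence a product of order
    [r^(q - 1) w^(A s - alpha_1 s)], at most [r^(e - eps) |x - s|^(- b)] for some
    [0 < b < 1 + alpha_1 s]; the last power is [mu_1]-integrable near [s], as a
    decomposition into dyadic scales shows. For the lower bound, a ball around an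
    interior point of the common support off [S] contributes [r^(q - 1)], and the
    points of the common support at distance of order [r] from [s] contribute
    [r^(q + A s)]. *)

Set Implicit Arguments.
Unset Strict Implicit.
Unset Printing Implicit Defensive.

(** * Real powers *)

Section powR_extra.
Context {R : realType}.
Implicit Types a b x y : R.

Lemma ler_powRl a x y : 0 <= a -> 0 <= x -> x <= y -> x `^ a <= y `^ a.
Proof.
move=> a0 x0 xy; have /= := @ge0_ler_powR R a a0 x y.
by rewrite !nnegrE => -> //; exact: le_trans xy.
Qed.

Lemma powR_le0_anti a x y : a <= 0 -> 0 < x -> x <= y -> y `^ a <= x `^ a.
Proof.
move=> a0 x0 xy; have y0 := lt_le_trans x0 xy.
rewrite -[a]opprK (powRN y (- a)) (powRN x (- a)) lef_pV2 ?posrE ?powR_gt0//.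
by apply: ler_powRl; rewrite ?oppr_ge0// ltW.
Qed.

(** The absolute value of [a] covers both signs: for [a >= 0] the loss comes from [k * y <= x]; for
    [a < 0], [x <= y] already suffices and the factor is at most 1. *)
Lemma powR_between_ge a k x y : 0 < k -> k <= 1 -> 0 < y -> k * y <= x -> x <= y ->
  k `^ `|a| * y `^ a <= x `^ a.
Proof.
move=> k0 k1 y0 kyx xy.
have x0 : 0 < x by apply: lt_le_trans kyx; exact: mulr_gt0.
have [a0|a0] := leP 0 a.
- rewrite ger0_norm// -powRM ?(ltW k0) ?(ltW y0)//.
  by apply: ler_powRl => //; rewrite ltW// mulr_gt0.
- apply: le_trans (powR_le0_anti (ltW a0) x0 xy).
  rewrite ler_piMl ?powR_ge0//.
  by rewrite -(powRr0 k); apply: ger_powR; rewrite ?k0.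
Qed.

Lemma powR_between_le a k x y : 0 < k -> k <= 1 -> 0 < y -> k * y <= x -> x <= k^-1 * y ->
  x `^ a <= k `^ (- `|a|) * y `^ a.
Proof.
move=> k0 k1 y0 kyx xky.
have x0 : 0 < x by apply: lt_le_trans kyx; exact: mulr_gt0.
have ky0 : 0 < k * y by exact: mulr_gt0.
have [a0|a0] := leP 0 a.
- have ki0 : 0 <= k^-1 by rewrite invr_ge0 ltW.
  have -> : k `^ (- `|a|) = k^-1 `^ a.
    by rewrite ger0_norm// -powR_inv1 ?(ltW k0)// -powRrM mulN1r.
  rewrite -powRM ?(ltW y0)//.
  by apply: ler_powRl => //; exact: ltW.
- rewrite ltr0_norm// opprK -powRM ?(ltW k0) ?(ltW y0)//.
  exact: powR_le0_anti (ltW a0) ky0 kyx.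
Qed.

Lemma powRD_gt0 x a b : 0 < x -> x `^ (a + b) = x `^ a * x `^ b.
Proof. by move=> x0; rewrite powRD// (gt_eqF x0) implybT. Qed.

Lemma powR_sum (J : Type) (s : seq J) (P : pred J) (f : J -> R) x : 0 < x ->
  x `^ (\sum_(j <- s | P j) f j) = \prod_(j <- s | P j) x `^ f j.
Proof.
move=> x0; elim/big_rec2 : _ => [|j y1 y2 _ <-]; first exact: powRr0.
by rewrite powRD_gt0.
Qed.

End powR_extra.

(** * Densities and supports *)

(* The library instance is stated without [nbhs], so inference misses it in
   [filterS2] and [filterS3]. *)
#[local] Instance ae_lebesgue_filter (R : realType) :
  Filter (nbhs (almost_everywhere (@lebesgue_measure R))).
Proof. exact: ae_filter_ringOfSetsType. Qed.

Section density.
Context {R : realType}.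
Variables (mu : probability (measurableTypeR R) R) (h : R -> R).
Hypothesis muh : is_density mu h.
Notation leb := (@lebesgue_measure R).

Let mh : measurable_fun [set: measurableTypeR R] (fun x : measurableTypeR R => (h x)%:E).
Proof. by case: muh => mh _ _; exact/measurable_EFinP. Qed.

Let mhD (A : set (measurableTypeR R)) : measurable_fun A (fun x => (h x)%:E).
Proof. exact: measurable_funS mh. Qed.

Let h0 x : 0 <= h x. Proof. by case: muh. Qed.

Lemma density_null (A : set (measurableTypeR R)) :
  measurable A -> leb A = 0%E -> mu A = 0%E.
Proof.
move=> mA A0; case: muh => _ _ ->//.
rewrite -[RHS](integral_abs_eq0 mA (mhD (A := A)) A0).
by apply: eq_integral => x _ /=; rewrite ger0_norm.
Qed.

Lemma density_le (A : set (measurableTypeR R)) c : measurable A -> 0 <= c ->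
  {ae leb, forall x, A x -> h x <= c} -> (mu A <= c%:E * leb A)%E.
Proof.
move=> mA c0 hc; case: muh => _ _ ->//.
rewrite -(integral_cst leb mA c%:E).
apply: ae_ge0_le_integral => //.
by move=> x _; rewrite lee_fin.
Qed.

Lemma density_ge (A : set (measurableTypeR R)) c : measurable A -> 0 <= c ->
  {ae leb, forall x, A x -> c <= h x} -> (c%:E * leb A <= mu A)%E.
Proof.
move=> mA c0 hc; case: muh => _ _ ->//.
rewrite -(integral_cst leb mA c%:E).
apply: ae_ge0_le_integral => //.
by move=> x _; rewrite lee_fin.
Qed.

Lemma density_eq0 (A : set (measurableTypeR R)) : measurable A ->
  mu A = 0%E -> {ae leb, forall x, A x -> h x = 0}.
Proof.
move=> mA; case: muh => _ _ ->// A0.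
have := @ae_eq_integral_abs _ _ _ leb A mA (fun x : measurableTypeR R => (h x)%:E) (mhD (A := A)).
case=> + _; rewrite (eq_integral (fun x : measurableTypeR R => (h x)%:E)); last first.
  by move=> x _ /=; rewrite ger0_norm.
by move=> /(_ A0); apply: filterS => x /= + Ax => /(_ Ax) [].
Qed.

(* Lindeloef: the complement of the support is covered by the null open
   intervals with rational endpoints. *)
Lemma supp_compl_null : exists N : set (measurableTypeR R),
  [/\ measurable N, mu N = 0%E & ~` supp mu `<=` N].
Proof.
pose V (p : rat * rat) : set (measurableTypeR R) := `]ratr p.1, ratr p.2[%classic.
have mV p : measurable (V p) by exact: measurable_itv.
pose F n : set (measurableTypeR R) :=
  if unpickle n is Some p then
    if mu (V p) == 0%E then V p else set0 else set0.
have mF n : measurable (F n).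
  by rewrite /F; case: unpickle => [p|//]; case: ifP.
have F0 n : mu.-negligible (F n).
  rewrite /F; case: unpickle => [p|]; last exact: negligible_set0.
  case: ifP => [/eqP V0|_]; last exact: negligible_set0.
  by apply/negligibleP.
exists (\bigcup_n F n); split.
- exact: bigcupT_measurable.
- apply/negligibleP; first exact: bigcupT_measurable.
  exact: negligible_bigcup.
- move=> x /= /existsNP [U /not_implyP [oU /not_implyP [Ux /negP]]].
  rewrite -leNgt measure_le0 => /eqP U0.
  have /nbhs_ballP [e /= e0 eU] : nbhs x U by exact: open_nbhs_nbhs.
  have /rat_in_itvoo [a] : x - e < x by rewrite ltrBlDr ltrDl.
  have /rat_in_itvoo [b] : x < x + e by rewrite ltrDl.
  rewrite !in_itv/= => /andP[xb be] /andP[ea ax].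
  have VU : V (a, b) `<=` U.
    move=> y; rewrite /V /= in_itv/= => /andP[ay yb]; apply: eU.
    by rewrite /ball/= ltr_distlC; apply/andP; split; lra.
  have V0 : mu (V (a, b)) = 0%E.
    apply/eqP; rewrite -measure_le0 -U0; apply: le_measure => //.
      by rewrite inE.
    by rewrite inE; exact: open_measurable.
  exists (pickle (a, b)); first exact: Logic.I.
  rewrite /F pickleK V0 eqxx /V.
  by apply/andP; split.
Qed.

Lemma density_off_supp : {ae leb, forall x, ~ supp mu x -> h x = 0}.
Proof.
have [N [mN N0 suppN]] := supp_compl_null.
by apply: filterS (density_eq0 mN N0) => x hx /suppN.
Qed.

(** The upper half of the power law extends from the support to the whole ball because [h] vanishes
    almost everywhere off the support. Discarding the null set of the point [s] makes the power
    positive, so that the quotient can be cleared. *)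
Lemma power_law_le s a : power_law_near mu h s a ->
  exists d C, [/\ 0 < d, 0 < C &
    {ae leb, forall x, ball s d x -> h x <= C * `|x - s| `^ a}].
Proof.
move=> [d d0 [c [C [c0 C0 hC]]]]; exists d, C; split => //.
have s0 : {ae leb, forall x, x != s}.
  exists [set s]; split => //; first by rewrite lebesgue_measure_set1.
  by move=> x /= /negP/negPn/eqP.
move: hC density_off_supp s0; apply: filterS3 => x hx off xs sx.
have p0 : 0 < `|x - s| `^ a by rewrite powR_gt0// normr_gt0 subr_eq0.
have [sx'|/off ->] := pselect (supp mu x); last by rewrite mulr_ge0 ?ltW.
by have [|_] := andP (hx _); [split|rewrite ler_pdivrMr].
Qed.

Lemma power_law_ge s a : power_law_near mu h s a ->
  exists d c, [/\ 0 < d, 0 < c &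
    {ae leb, forall x, supp mu x -> ball s d x -> c * `|x - s| `^ a <= h x}].
Proof.
move=> [d d0 [c [C [c0 C0 hC]]]]; exists d, c; split => //.
have s0 : {ae leb, forall x, x != s}.
  exists [set s]; split => //; first by rewrite lebesgue_measure_set1.
  by move=> x /= /negP/negPn/eqP.
move: hC s0; apply: filterS2 => x hx xs sx bx.
have p0 : 0 < `|x - s| `^ a by rewrite powR_gt0// normr_gt0 subr_eq0.
by have [|+ _] := andP (hx _); [split|rewrite ler_pdivlMr].
Qed.

End density.

(** * Singular integrals and measures of small balls *)

Section dyadic.
Context {R : realType}.
Implicit Types s d : R.

Lemma powR_lt1 (x a : R) : 0 <= x -> x < 1 -> 0 < a -> x `^ a < 1.
Proof.
move=> x0 x1 a0; have := @gt0_ltr_powR R a a0 x 1.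
by rewrite /= !nnegrE powR1 => ->.
Qed.

Lemma powR_exprn (x a : R) n : 0 <= x -> (x ^+ n) `^ a = (x `^ a) ^+ n.
Proof. by move=> x0; rewrite -powR_mulrn// powRAC powR_mulrn ?powR_ge0. Qed.

Lemma measurable_dist_powR s (a : R) (D : set (measurableTypeR R)) :
  measurable_fun D (fun x : measurableTypeR R => (`|(x : R) - s| `^ a)%:E).
Proof.
apply/measurable_EFinP; apply: measurable_funTS.
apply: (@measurableT_comp _ _ _ _ _ _ (fun y : R => y `^ a)).
  exact: measurable_powR.
apply: measurableT_comp => //.
by apply: measurable_funB.
Qed.

Lemma dyadic_scale d u : 0 < u -> u < d ->
  exists n, d * 2^-1 ^+ n.+1 <= u /\ u < d * 2^-1 ^+ n.
Proof.
move=> u0 ud; have d0 := lt_trans u0 ud.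
have ex : exists n, d * 2^-1 ^+ n <= u.
  have : geometric d 2^-1 n @[n --> \oo] --> (0 : R).
    by apply: cvg_geometric; rewrite ger0_norm ?invr_ge0// invf_lt1// ltr1n.
  move=> /cvgr0Pnorm_lt /(_ _ u0) [N _ /(_ N (leqnn N))] /= duN.
  by exists N; apply: ltW; apply: le_lt_trans duN; exact: ler_norm.
(* The least index with [d * 2^-1 ^+ n <= u] is positive because [u < d]; its predecessor is the
   scale sought. *)
case: (ex_minnP ex) => -[|n] dn minn.
  by exfalso; move: dn; rewrite expr0 mulr1 leNgt ud.
exists n; split => //; rewrite ltNge; apply/negP => /minn.
by rewrite ltnn.
Qed.

(* At [x = s] the integrand is the junk value [0 `^ (- b) = 0], so that an atom
   of [nu] at [s] does no harm. *)
Lemma dyadic_integral_le (nu : {measure set (measurableTypeR R) -> \bar R})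
    s d K g b : 0 < d -> 0 <= K -> 0 < b -> b < g ->
  (forall t, 0 < t -> t <= d -> (nu (ball s t) <= (K * t `^ g)%:E)%E) ->
  (\int[nu]_(x in ball s d) (`|(x : R) - s| `^ (- b))%:E <=
   (K * 2^-1 `^ (- b) / (1 - 2^-1 `^ (g - b)) * d `^ (g - b))%:E)%E.
Proof.
move=> d0 K0 b0 bg nuK.
pose z : R := 2^-1; pose y n := d * z ^+ n.
have z0 : 0 < z by rewrite invr_gt0.
have z1 : z < 1 by rewrite invf_lt1// ltr1n.
have y0 n : 0 < y n by rewrite mulr_gt0// exprn_gt0.
have yd n : y n <= d by rewrite ler_piMr ?(ltW d0)// exprn_ile1// ltW.
(* On the shell between the radii [y n.+1] and [y n] the integrand is at most its value at the inner
   radius. Using the full ball instead of the shell only enlarges the sum and lets the hypothesis on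
   [nu] apply directly. *)
pose f n (x : measurableTypeR R) : \bar R :=
  (y n.+1 `^ (- b) * \1_(ball s (y n) : set (measurableTypeR R)) x)%:E.
have f0 n x : (0 <= f n x)%E by rewrite lee_fin mulr_ge0 ?powR_ge0.
have mf n : measurable_fun setT (f n).
  apply/measurable_EFinP; apply: measurable_funM => //.
  by apply: measurable_indic; exact: measurable_ball.
have mB := @measurable_ball R s d.
apply: (@le_trans _ _ (\int[nu]_(x in ball s d) \sum_(n <oo) f n x)%E).
  apply: ge0_le_integral => //.
  - exact: measurable_dist_powR.
  - apply: ge0_emeasurable_sum => // n _; exact: measurable_funTS.
  - move=> x; rewrite /ball/= distrC => xd.
    have [->|xs] := eqVneq x s.
      rewrite subrr normr0 powR0 ?oppr_eq0 ?gt_eqF//.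
      exact: nneseries_ge0.
    have u0 : 0 < `|x - s| by rewrite normr_gt0 subr_eq0.
    have [n [n1 n2]] := dyadic_scale u0 xd.
    apply: le_trans (nneseries_lim_ge n.+1 _) => //.
    rewrite big_nat_recr//=; rewrite -[leLHS]add0e; apply: leeD; first exact: sume_ge0.
    rewrite /f lee_fin indicE mem_set ?mulr1; last first.
      by rewrite /= /ball/= distrC.
    by apply: powR_le0_anti => //; rewrite oppr_le0 ltW.
rewrite integral_nneseries//; last by move=> n; exact: measurable_funTS.
apply: lime_le; first by apply: is_cvg_nneseries => n _ _; exact: integral_ge0.
apply: nearW => N /=.
(* This is the bound for the term of index 0; the next ones decrease geometrically with ratio [z] to
   the power [g - b], which is less than 1 as [b < g]. *)
pose c := K * z `^ (- b) * d `^ (g - b).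
apply: (@le_trans _ _ (\sum_(0 <= n < N) (c * (z `^ (g - b)) ^+ n)%:E)%E).
  apply: lee_sum => n _.
  have -> : c * (z `^ (g - b)) ^+ n = y n.+1 `^ (- b) * (K * y n `^ g).
    have -> : y n.+1 = y n * z by rewrite /y exprSr mulrA.
    rewrite powRM ?(ltW z0) ?(ltW (y0 n))//.
    transitivity (K * z `^ (- b) * y n `^ (g - b)).
      rewrite /c -!mulrA; congr (_ * (_ * _)).
      by rewrite /y powRM ?(ltW d0) ?exprn_ge0 ?(ltW z0)// powR_exprn// ltW.
    by rewrite powRD_gt0//; ring.
  rewrite /f; under eq_integral do rewrite EFinM.
  have mI : measurable_fun (ball s d : set (measurableTypeR R))
      (fun x : measurableTypeR R => (\1_(ball s (y n)) x : R)%:E).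
    by apply/measurable_EFinP; apply: measurable_indic; exact: measurable_ball.
  rewrite ge0_integralZl_EFin ?powR_ge0//.
  rewrite integral_indic//; last exact: measurable_ball.
  rewrite EFinM; apply: lee_wpmul2l; first by rewrite lee_fin powR_ge0.
  apply: le_trans (nuK _ (y0 n) (yd n)).
  apply: le_measure; rewrite ?inE//.
  - by apply: measurableI => //; exact: measurable_ball.
  - exact: measurable_ball.
rewrite sumEFin lee_fin.
have q0 : 0 < z `^ (g - b) by rewrite powR_gt0.
have q1 : z `^ (g - b) < 1.
  by apply: powR_lt1; rewrite ?subr_gt0// ltW.
have := @geometric_le_lim _ N c _ _ q0 _.
rewrite /series/= ger0_norm ?(ltW q0)// => /(_ _ q1) H.
apply: le_trans (H _) _; first by rewrite !mulr_ge0 ?powR_ge0.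
by rewrite /c -/z le_eqVlt; apply/orP; left; apply/eqP; ring.
Qed.

End dyadic.

Section ball_measure.
Context {R : realType}.
Variables (mu : probability (measurableTypeR R) R) (h : R -> R).
Hypothesis muh : is_density mu h.
Notation leb := (@lebesgue_measure R).
Variables (s d C a : R).
Hypotheses (C0 : 0 < C) (a1 : -1 < a).
Hypothesis hC : {ae leb, forall x, ball s d x -> h x <= C * `|x - s| `^ a}.

(** For [a >= 0] the density is at most [C] times the [a]-th power of [t] on the ball. For [a < 0]
    the singularity is integrated over dyadic scales against Lebesgue measure, with [g = 1] and
    [b = - a < 1]. *)
Lemma centered_ball_le : exists2 K, 0 < K & forall t, 0 < t -> t <= d ->
  (mu (ball s t) <= (K * t `^ (1 + a))%:E)%E.
Proof.
have [a0|a0] := leP 0 a.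
  exists (2 * C) => [|t t0 td]; first by rewrite mulr_gt0.
  have := @density_le _ _ _ muh (ball s t) (C * t `^ a).
  move=> /(_ (measurable_ball _ _)) /(_ (mulr_ge0 (ltW C0) (powR_ge0 _ _))).
  have hae : {ae leb, forall x, ball s t x -> h x <= C * t `^ a}.
    apply: filterS hC => x hx xt; apply: le_trans (hx _) _.
      exact: le_ball xt.
    rewrite ler_pM2l//; apply: ler_powRl => //.
    by move: xt; rewrite /ball/= distrC => /ltW.
  move=> /(_ hae) /le_trans; apply; rewrite lebesgue_measure_ball ?(ltW t0)//.
  rewrite lee_fin powRD_gt0// powRr1 ?(ltW t0)//.
  by rewrite le_eqVlt; apply/orP; left; apply/eqP; ring.
have b1 : 0 < 1 - 2^-1 `^ (1 + a).
  rewrite subr_gt0; apply: powR_lt1 => //; last by rewrite addrC -ltrBlDr sub0r.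
  by rewrite invf_lt1// ltr1n.
exists (C * (2 * 2^-1 `^ a / (1 - 2^-1 `^ (1 + a)))) => [|t t0 td].
  by rewrite !mulr_gt0 ?invr_gt0 ?powR_gt0.
have mB := @measurable_ball R s t.
have [mh h0 ->//] := muh.
apply: (@le_trans _ _ (\int[leb]_(x in ball s t) (C%:E * (`|(x : R) - s| `^ (- - a))%:E))%E).
  apply: ae_ge0_le_integral => //.
  - by move=> x _; rewrite lee_fin.
  - by apply/measurable_EFinP; exact: measurable_funS mh.
  - by move=> x _; rewrite mule_ge0// ?lee_fin ?powR_ge0// ltW.
  - by apply: emeasurable_funM => //; exact: measurable_dist_powR.
  - apply: filterS hC => x hx xt; rewrite opprK lee_fin; apply: hx.
    exact: le_ball xt.
rewrite ge0_integralZl_EFin ?(ltW C0)//; last exact: measurable_dist_powR.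
rewrite -(mulrA C) EFinM; apply: lee_wpmul2l; first by rewrite lee_fin ltW.
have := @dyadic_integral_le R leb s t 2 1 (- a) t0.
rewrite !opprK; apply => //.
- by rewrite oppr_gt0.
- by rewrite ltrNl.
- move=> u u0 _.
  suff : (lebesgue_measure (ball s u) <= (2 * u `^ 1)%:E)%E by [].
  rewrite lebesgue_measure_ball ?(ltW u0)//.
  by rewrite powRr1 ?(ltW u0)// mulr_natl.
Qed.

(** If [|x - s| >= 2 r], all points of the ball are at distance comparable to [|x - s|] from [s], so
    the density is controlled pointwise. Otherwise the ball lies in the one of radius [3 r] around
    [s], and the maximum is between [r] and [2 r]. The bound [d / 4] keeps both cases inside
    [ball s d]. *)
Lemma moving_ball_le : exists2 K, 0 < K & forall r x, 0 < r -> r < d / 4 ->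
  `|x - s| < d / 4 ->
  (mu (ball x r) <= (K * (r * (Num.max `|x - s| r) `^ a))%:E)%E.
Proof.
have [K1 K10 muK] := centered_ball_le.
pose k2 : R := 2^-1 `^ (- `|a|); pose k3 : R := 3^-1 `^ (- `|a|).
have k20 : 0 < k2 by rewrite powR_gt0.
have k30 : 0 < k3 by rewrite powR_gt0.
exists (C * k2 * 2 + K1 * 3 * k3) => [|r x r0 rd xd].
  by rewrite addr_gt0// !mulr_gt0.
set w := Num.max _ _.
have w0 : 0 < w by rewrite lt_max r0 orbT.
have rw : r <= w by rewrite le_max lexx orbT.
have rwa : 0 <= r * w `^ a by rewrite mulr_ge0 ?powR_ge0 ?ltW.
have [xr|xr] := leP (2 * r) `|x - s|.
  have wE : w = `|x - s| by apply/max_idPl; lra.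
  have := @density_le _ _ _ muh (ball x r) (C * (k2 * w `^ a)).
  move=> /(_ (measurable_ball _ _)).
  have c0 : 0 <= C * (k2 * w `^ a) by rewrite !mulr_ge0 ?powR_ge0 ?ltW.
  have hae : {ae leb, forall y, ball x r y -> h y <= C * (k2 * w `^ a)}.
    apply: filterS hC => y hy xy; move: (xy); rewrite /ball/= => xy'.
    have t1 : `|y - s| <= `|x - s| + `|x - y|.
      by rewrite (distrC x y) (addrC `|x - s|) ler_distD.
    have t2 : `|x - s| <= `|y - s| + `|x - y|.
      by rewrite (addrC `|y - s|) ler_distD.
    apply: le_trans (hy _) _; first by rewrite /ball/= distrC; lra.
    rewrite ler_pM2l//; apply: powR_between_le => //.
    - by rewrite invf_le1// ler1n.
    - by rewrite wE; lra.
    - by rewrite invrK wE; lra.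
  move=> /(_ c0 hae) /le_trans; apply; rewrite lebesgue_measure_ball ?(ltW r0)//.
  rewrite lee_fin (mulrDl (C * k2 * 2)) -[leLHS]addr0 lerD//; last first.
    by rewrite !mulr_ge0 ?powR_ge0// ltW.
  by rewrite le_eqVlt; apply/orP; left; apply/eqP; ring.
have xr3 : ball x r `<=` ball s (3 * r).
  move=> y; rewrite /ball/= (distrC x) (distrC s) => xy.
  by apply: le_lt_trans (ler_distD x _ _) _; lra.
apply: (@le_trans _ _ (mu (ball s (3 * r)))).
  by apply: le_measure; rewrite ?inE//; exact: measurable_ball.
apply: le_trans (muK _ _ _) _; [lra|lra|rewrite lee_fin].
rewrite (mulrDl (C * k2 * 2)) -[leLHS]add0r lerD//; first by rewrite mulr_ge0// !mulr_ge0 ?ltW.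
rewrite powRD_gt0 ?mulr_gt0// powRr1 ?mulr_ge0 ?(ltW r0)//.
apply: (@le_trans _ _ (K1 * (3 * r * (k3 * w `^ a)))).
  rewrite ler_pM2l// ler_pM2l ?mulr_gt0//.
  have w2 : w < 2 * r by rewrite gt_max xr; lra.
  apply: powR_between_le => //; [|lra|rewrite invrK; lra].
  by rewrite invf_le1// ler1n.
by rewrite le_eqVlt; apply/orP; left; apply/eqP; ring.
Qed.

End ball_measure.

Lemma finite_pos_lbound (R : realType) (T : eqType) (l : seq T) (d : T -> R) :
  (forall x, x \in l -> 0 < d x) ->
  exists2 e, 0 < e & forall x, x \in l -> e <= d x.
Proof.
elim: l => [_|y l ih dpos]; first by exists 1.
have [|e e0 el] := ih; first by move=> x xl; apply: dpos; rewrite inE xl orbT.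
exists (Num.min (d y) e).
  by rewrite lt_min e0 andbT; apply: dpos; rewrite inE eqxx.
move=> x; rewrite inE => /predU1P[->|/el ex]; first by rewrite ge_min lexx.
by rewrite ge_min ex orbT.
Qed.

(** The ball around [x] is the section at [x] of a measurable strip around the diagonal of the
    plane, and measures of sections depend measurably on the point. *)
Lemma measurable_measure_ball (R : realType)
    (mu : probability (measurableTypeR R) R) (r : R) :
  measurable_fun [set: measurableTypeR R] (fun x => mu (ball (x : R) r)).
Proof.
pose A : set (measurableTypeR R * measurableTypeR R) :=
  [set p | `|(p.1 : R) - p.2| < r].
have mA : measurable A.
  have mg : measurable_fun setT
      (fun p : measurableTypeR R * measurableTypeR R => `|(p.1 : R) - p.2| : R).
    apply: measurableT_comp => //.
    by apply: measurable_funB; [exact: measurable_fst|exact: measurable_snd].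
  rewrite (_ : A = setT `&` (fun p => `|(p.1 : R) - p.2| : R) @^-1` `]-oo, r[).
    by apply: mg => //; exact: measurable_itv.
  by rewrite setTI; apply/seteqP; split => p /=; rewrite in_itv.
rewrite (_ : (fun x => _) = mu \o xsection A).
  exact: measurable_fun_xsection.
apply/funext => x /=; congr (mu _).
by apply/seteqP; split => y; rewrite /xsection /A /ball/= inE.
Qed.

(** * Products of measures of balls *)

Section ball_prod.
Context {R : realType} (J : finType) (j0 : J).
Variable mu : J -> probability (measurableTypeR R) R.

Definition ball_prod (r : R) (x : measurableTypeR R) : \bar R :=
  (\prod_(j | j != j0) mu j (ball (x : R) r))%E.

Let fine_mu j (A : set (measurableTypeR R)) : measurable A ->
  ((fine (mu j A))%:E = mu j A)%E.
Proof. by move=> mA; rewrite fineK//; exact: fin_num_measure. Qed.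

Lemma ball_prodE r x :
  ball_prod r x = (\prod_(j | j != j0) fine (mu j (ball (x : R) r)))%:E.
Proof.
rewrite -prodEFin; apply: eq_bigr => j _.
by rewrite fine_mu//; exact: measurable_ball.
Qed.

Lemma ball_prod_ge0 r x : (0 <= ball_prod r x)%E.
Proof.
by rewrite ball_prodE lee_fin; apply: prodr_ge0 => j _; exact: fine_ge0.
Qed.

Lemma measurable_ball_prod r (D : set (measurableTypeR R)) :
  measurable_fun D (ball_prod r).
Proof.
apply: measurable_funTS.
rewrite (_ : ball_prod r = fun x =>
  (\prod_(j <- [seq j <- enum J | j != j0]) fine (mu j (ball (x : R) r)))%:E).
  apply/measurable_EFinP.
  apply: measurable_prod => j _; apply: measurableT_comp => //.
  exact: measurable_measure_ball.
by apply/funext => x; rewrite ball_prodE big_filter big_enum_cond.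
Qed.

Lemma ball_prod_le r (x : R) (B : J -> R) :
  (forall j, j != j0 -> (mu j (ball x r) <= (B j)%:E)%E) ->
  (ball_prod r x <= (\prod_(j | j != j0) B j)%:E)%E.
Proof.
move=> muB; rewrite ball_prodE lee_fin; apply: ler_prod => j jj0.
rewrite fine_ge0//= -lee_fin fine_mu; last exact: measurable_ball.
exact: muB.
Qed.

Lemma ball_prod_ge r (x : R) (B : J -> R) :
  (forall j, 0 <= B j) ->
  (forall j, ((B j)%:E <= mu j (ball x r))%E) ->
  ((\prod_(j | j != j0) B j)%:E <= ball_prod r x)%E.
Proof.
move=> B0 muB; rewrite ball_prodE lee_fin; apply: ler_prod => j jj0.
rewrite B0/= -lee_fin fine_mu; last exact: measurable_ball.
exact: muB.
Qed.

Lemma prodC1_const (c : R) : \prod_(j | j != j0) c = c ^+ #|J|.-1.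
Proof. by rewrite -(cardC1 j0) -prodr_const. Qed.

(** The bound is localised to [U] so that the estimates near the points of [S] and far from them can
    be glued along a finite cover. *)
Definition ball_prod_upper (E : R) (U : set (measurableTypeR R)) : Prop :=
  exists2 C, 0 < C & \forall r \near (0 : R)^'+,
    (\int[mu j0]_(x in U) ball_prod r x <= (C * r `^ E)%:E)%E.

Lemma ball_prod_upperU E (U V : set (measurableTypeR R)) :
  measurable U -> measurable V ->
  ball_prod_upper E U -> ball_prod_upper E V -> ball_prod_upper E (U `|` V).
Proof.
move=> mU mV [C C0 hU] [D D0 hV]; exists (C + D); first exact: addr_gt0.
have UV : U `|` V = U `|` (V `\` U) by rewrite setDE setUIr setUCr setIT.
have mVU : measurable (V `\` U) by exact: measurableD.
near=> r; rewrite UV ge0_integral_setU//; first last.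
- by apply/disj_setPS => x [Ux []].
- by move=> x _; exact: ball_prod_ge0.
- exact: measurable_ball_prod.
rewrite mulrDl EFinD; apply: leeD; first by near: r.
apply: (@le_trans _ _ (\int[mu j0]_(x in V) ball_prod r x)%E).
  apply: ge0_subset_integral => //; first exact: measurable_ball_prod.
  by move=> x _; exact: ball_prod_ge0.
by near: r.
Unshelve. all: by end_near. Qed.

End ball_prod.

(** * Upper bound *)

Section upper_bound.
Context {R : realType} (J : finType) (j0 : J).
Variables (mu : J -> probability (measurableTypeR R) R) (h : J -> R -> R).
Hypothesis muh : forall j, is_density (mu j) (h j).

Lemma ball_prod_upper_local (alpha : J -> R) (s E : R) :
  (forall j, -1 < alpha j) ->
  (forall j, power_law_near (mu j) (h j) s (alpha j)) ->
  E <= #|J|.-1%:R -> E < #|J|.-1%:R + 1 + \sum_j alpha j ->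
  exists2 d, 0 < d & ball_prod_upper j0 mu E (ball s d).
Proof.
move=> a1 hpl E1 E2.
have bound j : exists p : R * R, [/\ 0 < p.1, 0 < p.2 &
    forall r x, 0 < r -> r < p.1 -> `|x - s| < p.1 ->
    (mu j (ball x r) <= (p.2 * (r * (Num.max `|x - s| r) `^ alpha j))%:E)%E].
  have [d [C [d0 C0 hC]]] := power_law_le (muh j) (hpl j).
  have [K K0 muK] := moving_ball_le (muh j) C0 (a1 j) hC.
  by exists (d / 4, K) => /=; split => //; rewrite divr_gt0.
have [p hp] := choice bound.
have [d1 [C1 [d10 C10 hC1]]] := power_law_le (muh j0) (hpl j0).
have [K1 K10 muK1] := centered_ball_le (muh j0) C10 (a1 j0) hC1.
have [e e0 ep] := @finite_pos_lbound R J (enum J) (fun j => (p j).1)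
  (fun j _ => let: And3 p1 _ _ := hp j in p1).
(* The 1 ensures that [r] and [w] below are at most 1, so that their powers decrease in the
   exponent. *)
pose d := Num.min 1 (Num.min d1 e).
have d0 : 0 < d by rewrite !lt_min ltr01 d10 e0.
have dle1 : d <= 1 by rewrite ge_min lexx.
have dd1 : d <= d1 by rewrite !ge_min lexx orbT.
have dp j : d <= (p j).1.
  apply: (@le_trans _ _ e); first by rewrite !ge_min lexx !orbT.
  by apply: ep; rewrite mem_enum.
exists d => //.
set A := \sum_j alpha j in E2.
have AE : A = alpha j0 + \sum_(j | j != j0) alpha j by rewrite /A (bigD1 j0).
have a10 := a1 j0.
(* The first term is the slack in the exponent [E]; the second keeps [b] positive, while [eps > 0]
   gives [b < 1 + alpha j0], as the dyadic estimate requires. *)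
pose eps := Num.min (#|J|.-1%:R + 1 + A - E) ((1 + alpha j0) / 2).
have eps0 : 0 < eps by rewrite lt_min; apply/andP; split; lra.
have epsE : eps <= #|J|.-1%:R + 1 + A - E by rewrite ge_min lexx.
have epsa : eps <= (1 + alpha j0) / 2 by rewrite ge_min lexx orbT.
pose b := 1 + alpha j0 - eps.
have b0 : 0 < b by rewrite /b; lra.
have b1 : b < 1 + alpha j0 by rewrite /b; lra.
have := dyadic_integral_le (nu := mu j0) d0 (ltW K10) b0 b1
  (fun t t0 td => muK1 t t0 (le_trans td dd1)).
set D := (X in (_ <= X%:E)%E) => intD.
pose Kp := \prod_(j | j != j0) (p j).2.
have Kp0 : 0 < Kp by apply: prodr_gt0 => j _; case: (hp j).
have D1 : D <= Num.max D 1 by rewrite le_max lexx.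
exists (Kp * Num.max D 1); first by rewrite mulr_gt0// lt_max ltr01 orbT.
near=> r.
have r0 : 0 < r by near: r; exact: nbhs_right_gt.
have rd : r < d by near: r; exact: nbhs_right_lt.
have r1 : r <= 1 by lra.
have bnd (x : R) : `|x - s| < d -> x != s ->
    (ball_prod j0 mu r x <= ((Kp * r `^ E) * `|x - s| `^ (- b))%:E)%E.
  move=> xd xs; set w := Num.max `|x - s| r.
  have w0 : 0 < w by rewrite lt_max r0 orbT.
  have w1 : w <= 1 by rewrite ge_max r1 andbT; lra.
  have rw : r <= w by rewrite le_max lexx orbT.
  have u0 : 0 < `|x - s| by rewrite normr_gt0 subr_eq0.
  apply: le_trans (ball_prod_le (B := fun j => (p j).2 * (r * w `^ alpha j)) _) _.
    move=> j _; case: (hp j) => _ _; apply => //.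
    - exact: lt_le_trans rd (dp j).
    - exact: lt_le_trans xd (dp j).
  rewrite lee_fin !big_split/= prodC1_const -powR_sum// -/Kp -!mulrA ler_pM2l//.
  (* The first power of [w] is compared with a power of [r]; the second one
     is at most [|x - s| `^ (- b)], which is [mu j0]-integrable near [s]. *)
  have -> : \sum_(j | j != j0) alpha j = (A + 1 - eps) + (- b).
    by rewrite /b AE; ring.
  rewrite powRD_gt0// mulrA ler_pM//.
  - by rewrite mulr_ge0 ?powR_ge0// exprn_ge0// ltW.
  - exact: powR_ge0.
  - rewrite -powR_mulrn ?(ltW r0)//.
    (* A nonnegative power of [w <= 1] is at most 1, and [E <= #|J|.-1] suffices. A negative power
       of [w] is at most the same power of [r <= w], and the choice of [eps] leaves an exponent at
       least [E]. *)
    have [c0|c0] := leP 0 (A + 1 - eps).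
      rewrite -[leRHS]mulr1 ler_pM ?powR_ge0//.
        by apply: ger_powR => //; rewrite r0.
      by rewrite -[leRHS](powRr0 w); apply: ger_powR => //; rewrite w0.
    apply: (@le_trans _ _ (r `^ #|J|.-1%:R * r `^ (A + 1 - eps))).
      rewrite ler_pM2l ?powR_gt0//; apply: powR_le0_anti => //; exact: ltW.
    by rewrite -powRD_gt0//; apply: ger_powR; rewrite ?r0//; lra.
  - by apply: powR_le0_anti => //; [rewrite oppr_le0 ltW|rewrite le_max lexx].
apply: (@le_trans _ _ (\int[mu j0]_(x in ball s d)
    ((Kp * r `^ E)%:E * (`|(x : R) - s| `^ (- b))%:E))%E).
  apply: ae_ge0_le_integral => //.
  - exact: measurable_ball.
  - by move=> x _; exact: ball_prod_ge0.
  - exact: measurable_ball_prod.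
  - by move=> x _; rewrite lee_fin !mulr_ge0 ?powR_ge0 ?(ltW Kp0).
  - by apply: emeasurable_funM => //; exact: measurable_dist_powR.
  (* The pointwise bound may fail at [x = s], where the power on the right takes the default value
     0; that point is [mu j0]-null by absolute continuity. *)
  - exists [set s]; split => //.
      by apply: (density_null (muh j0)) => //; exact: lebesgue_measure_set1.
    move=> x /=; apply: contra_notP => /eqP xs.
    by rewrite /ball/= distrC => xd; apply: bnd.
rewrite ge0_integralZl_EFin; first last.
- by rewrite mulr_ge0 ?powR_ge0// ltW.
- exact: measurable_dist_powR.
- by move=> x _; rewrite lee_fin powR_ge0.
- exact: measurable_ball.
apply: (@le_trans _ _ ((Kp * r `^ E)%:E * D%:E)%E).
  by apply: lee_wpmul2l => //; rewrite lee_fin mulr_ge0 ?powR_ge0 ?ltW.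
rewrite -EFinM lee_fin -mulrA (mulrC _ D) mulrA ler_wpM2r ?powR_ge0//.
by rewrite ler_pM2l.
Unshelve. all: by end_near. Qed.

(** For [r < d / 2], a ball around a point of [U] stays at distance [d / 2] from [S], where the
    densities are bounded; each factor is then at most linear in [r]. *)
Lemma ball_prod_upper_far (S : seq R) (d : R) : 0 < d ->
  (forall j, no_singularity_off S (h j)) ->
  forall (U : set (measurableTypeR R)), measurable U ->
  (forall x s, U x -> s \in S -> d <= `|(x : R) - s|) ->
  forall E, E <= #|J|.-1%:R -> ball_prod_upper j0 mu E U.
Proof.
move=> d0 hS U mU Ud E E1.
have d20 : 0 < d / 2 by rewrite divr_gt0.
have [M hM] := choice (fun j => hS j _ d20).
pose B j := 2 * Num.max (M j) 1.
have B0 j : 0 < B j by rewrite mulr_gt0// lt_max ltr01 orbT.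
exists (\prod_(j | j != j0) B j); first exact: prodr_gt0.
near=> r.
have r0 : 0 < r by near: r; exact: nbhs_right_gt.
have rd : r < d / 2 by near: r; exact: nbhs_right_lt.
have r1 : r <= 1 by apply: ltW; near: r; exact: nbhs_right_lt.
pose c := (\prod_(j | j != j0) B j) * r `^ E.
have c0 : 0 <= c by rewrite mulr_ge0 ?powR_ge0//; apply: prodr_ge0 => j _; exact: ltW.
apply: (@le_trans _ _ (\int[mu j0]_(x in U) c%:E)%E).
  apply: ge0_le_integral => //.
  - by move=> x _; exact: ball_prod_ge0.
  - exact: measurable_ball_prod.
  move=> x Ux; apply: le_trans (ball_prod_le (B := fun j => B j * r) _) _.
    move=> j _; have := @density_le _ _ _ (muh j) (ball (x : R) r) (Num.max (M j) 1).
    move=> /(_ (measurable_ball _ _)).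
    have m0 : 0 <= Num.max (M j) 1 by rewrite le_max ler01 orbT.
    move=> /(_ m0); rewrite lebesgue_measure_ball ?(ltW r0)// => /(_ _)/le_trans.
    apply.
      apply: filterS (hM j) => y hy xy; rewrite le_max hy// => s /(Ud _ _ Ux) xs.
      move: xy; rewrite /ball/= => xy.
      by have := ler_distD y (x : R) s; lra.
    by rewrite lee_fin le_eqVlt; apply/orP; left; apply/eqP; rewrite /B; ring.
  rewrite lee_fin big_split/= prodC1_const /c ler_wpM2l//.
    by apply: prodr_ge0 => j _; exact: ltW.
  rewrite -powR_mulrn ?(ltW r0)//; apply: ger_powR => //; by rewrite r0.
rewrite integral_cst// -[leRHS]mule1; apply: lee_wpmul2l.
  by rewrite lee_fin.
exact: probability_le1.
Unshelve. all: by end_near. Qed.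

Lemma ball_prod_upper_global (S : seq R) (alpha : J -> R -> R) (E : R) :
  (forall j s, s \in S -> -1 < alpha j s) ->
  (forall j s, s \in S -> power_law_near (mu j) (h j) s (alpha j s)) ->
  (forall j, no_singularity_off S (h j)) ->
  E <= #|J|.-1%:R ->
  (forall s, s \in S -> E < #|J|.-1%:R + 1 + \sum_j alpha j s) ->
  ball_prod_upper j0 mu E setT.
Proof.
move=> a1 hpl hS E1 E2.
(* Off [S] the radius is a dummy 1, so that [choice] yields a function on all of [R]. *)
have bound s : exists d, 0 < d /\ (s \in S -> ball_prod_upper j0 mu E (ball s d)).
  have [sS|sS] := boolP (s \in S); last by exists 1.
  have [|||d d0 hd] := @ball_prod_upper_local (alpha ^~ s) s E _ _ E1.
  - by move=> j; exact: a1.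
  - by move=> j; exact: hpl.
  - exact: E2.
  by exists d.
have [d hd] := choice bound.
have [e e0 ed] := @finite_pos_lbound R R S d (fun s _ => proj1 (hd s)).
pose V : set (measurableTypeR R) := \big[setU/set0]_(s <- S) ball s (d s).
have mV : measurable V by apply: bigsetU_measurable => s _; exact: measurable_ball.
have VS l : {subset l <= S} ->
    ball_prod_upper j0 mu E (\big[setU/set0]_(s <- l) ball s (d s)).
  elim: l => [_|s l ih lS]; rewrite ?big_nil ?big_cons.
    by exists 1 => //; near=> r; rewrite integral_set0 lee_fin mul1r powR_ge0.
  apply: ball_prod_upperU.
  - exact: measurable_ball.
  - by apply: bigsetU_measurable => t _; exact: measurable_ball.
  - by apply: (proj2 (hd s)); apply: lS; rewrite inE eqxx.
  - by apply: ih => t tl; apply: lS; rewrite inE tl orbT.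
rewrite -(setUv V); apply: ball_prod_upperU => //; [exact: measurableC|exact: VS|].
apply: (ball_prod_upper_far e0 hS) => //; first exact: measurableC.
move=> x s Vx sS; rewrite leNgt; apply/negP => xs; apply: Vx.
rewrite /V -bigcup_seq; exists s => //=; rewrite /ball/= distrC.
exact: lt_le_trans xs (ed _ sS).
Unshelve. all: by end_near. Qed.

End upper_bound.

(** * Lower bound *)

Section lower_bound.
Context {R : realType} (J : finType) (j0 : J).
Variables (mu : J -> probability (measurableTypeR R) R) (h : J -> R -> R).
Hypothesis muh : forall j, is_density (mu j) (h j).

Definition ball_prod_lower (E : R) : Prop :=
  exists2 c, 0 < c & \forall r \near (0 : R)^'+,
    ((c * r `^ E)%:E <= \int[mu j0]_x ball_prod j0 mu r x)%E.

Lemma ball_prod_integral_ge (K : set (measurableTypeR R)) r (B : R) :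
  measurable K -> 0 <= B ->
  (forall x, K x -> (B%:E <= ball_prod j0 mu r x)%E) ->
  (B%:E * mu j0 K <= \int[mu j0]_x ball_prod j0 mu r x)%E.
Proof.
move=> mK B0 BK; rewrite -integral_cst//.
apply: (@le_trans _ _ (\int[mu j0]_(x in K) ball_prod j0 mu r x)%E).
  by apply: ge0_le_integral => //; exact: measurable_ball_prod.
apply: ge0_subset_integral => //; first exact: measurable_ball_prod.
by move=> x _; exact: ball_prod_ge0.
Qed.

(* [lo r, lo r + r / 4] is on the side of [s] where the supports overlap; being
   of length [r / 4], it lies in [ball x r] for each of its points [x]. *)
Lemma ball_prod_lower_singular (alpha : J -> R) (s : R) (lo : R -> R) :
  (forall j, power_law_near (mu j) (h j) s (alpha j)) ->
  (\forall r \near (0 : R)^'+, forall x, lo r <= x <= lo r + r / 4 ->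
    r / 4 <= `|x - s| <= r / 2 /\ forall j, supp (mu j) x) ->
  ball_prod_lower (#|J|.-1%:R + 1 + \sum_j alpha j).
Proof.
move=> hpl Hlo.
have bound j : exists p : R * R, [/\ 0 < p.1, 0 < p.2 &
    {ae (@lebesgue_measure R), forall x, supp (mu j) x -> ball s p.1 x ->
       p.2 * `|x - s| `^ alpha j <= h j x}].
  by have [d [c [d0 c0 hc]]] := power_law_ge (hpl j); exists (d, c).
have [p hp] := choice bound.
have [e e0 ep] := @finite_pos_lbound R J (enum J) (fun j => (p j).1)
  (fun j _ => let: And3 p1 _ _ := hp j in p1).
(* The power of [4^-1] compares [|x - s|], at least [r / 4], with [r]; the final division by 4 comes
   from the length [r / 4] of [K]. *)
pose b j := (p j).2 * 4^-1 `^ `|alpha j| / 4.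
have b0 j : 0 < b j.
  by case: (hp j) => _ c0 _; rewrite /b divr_gt0// mulr_gt0// powR_gt0// invr_gt0.
exists (\prod_j b j); first by apply: prodr_gt0 => j _; exact: b0.
near=> r.
have r0 : 0 < r by near: r; exact: nbhs_right_gt.
have re : r < e by near: r; exact: nbhs_right_lt.
have Hr : forall x, lo r <= x <= lo r + r / 4 ->
  r / 4 <= `|x - s| <= r / 2 /\ forall j, supp (mu j) x by near: r.
pose K : set (measurableTypeR R) := `[lo r, lo r + r / 4]%classic.
have mK : measurable K by exact: measurable_itv.
have muK j : ((b j * (r * r `^ alpha j))%:E <= mu j K)%E.
  have [d0 c0 hc] := hp j.
  have := @density_ge _ _ _ (muh j) K ((p j).2 * (4^-1 `^ `|alpha j| * r `^ alpha j)) mK.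
  have q0 : 0 <= (p j).2 * (4^-1 `^ `|alpha j| * r `^ alpha j).
    by rewrite !mulr_ge0 ?powR_ge0// ltW.
  move=> /(_ q0); rewrite /K lebesgue_measure_itv/= lte_fin ltrDl divr_gt0//.
  rewrite -EFinB addrAC subrr add0r => H; apply: le_trans (H _).
    by rewrite -EFinM lee_fin /b le_eqVlt; apply/orP; left; apply/eqP; ring.
  apply: filterS hc => x hx; rewrite /= in_itv/= => /Hr[/andP[x1 x2] sx].
  have ej : e <= (p j).1 by apply: ep; rewrite mem_enum.
  apply: le_trans (hx (sx j) _); last by rewrite /ball/= distrC; lra.
  rewrite ler_pM2l//; apply: powR_between_ge => //; last lra.
  - by rewrite invf_le1// ler1n.
  - by rewrite mulrC.
have KB x : K x -> K `<=` ball (x : R) r.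
  rewrite /K /= in_itv/= => /andP[x1 x2] y /=; rewrite in_itv/= => /andP[y1 y2].
  by rewrite /ball/= ltr_norml; apply/andP; split; lra.
pose B := \prod_(j | j != j0) (b j * (r * r `^ alpha j)).
have br0 j : 0 <= b j * (r * r `^ alpha j).
  by rewrite ltW// mulr_gt0// mulr_gt0// powR_gt0.
have B0 : 0 <= B by exact: prodr_ge0.
have BK x : K x -> (B%:E <= ball_prod j0 mu r x)%E.
  move=> Kx; apply: ball_prod_ge => j; first exact: br0.
  apply: le_trans (muK j) _; apply: le_measure; rewrite ?inE//.
    exact: measurable_ball.
  exact: KB.
apply: le_trans (ball_prod_integral_ge mK B0 BK).
(* The measure [mu j0 K] supplies the factor of index [j0] absent from [B], so the product now runs
   over all of [J]. *)
apply: (@le_trans _ _ (B%:E * (b j0 * (r * r `^ alpha j0))%:E)%E); last first.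
  by apply: lee_wpmul2l.
rewrite -EFinM lee_fin mulrC.
have -> : B * (b j0 * (r * r `^ alpha j0)) = \prod_j (b j * (r * r `^ alpha j)).
  by rewrite (bigD1 j0)//= mulrC.
have -> : \prod_j (b j * (r * r `^ alpha j)) =
    (\prod_j b j) * (r ^+ #|J| * r `^ (\sum_j alpha j)).
  rewrite big_split; congr (_ * _).
  by rewrite big_split/= prodr_const -powR_sum.
rewrite mulrC powRD_gt0// powRD_gt0// powRr1 ?(ltW r0)// powR_mulrn ?(ltW r0)//.
rewrite -exprSr prednK//.
by apply/card_gt0P; exists j0.
Unshelve. all: by end_near. Qed.

(** An exponent 0 bounds the densities from below near [p]. Hence each factor is at least linear in
    [r] for all [x] in a fixed ball around [p], which itself has positive [mu j0]-measure. *)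
Lemma ball_prod_lower_regular (p e : R) : 0 < e ->
  (forall j, ball p e `<=` supp (mu j)) ->
  (forall j, power_law_near (mu j) (h j) p 0) ->
  ball_prod_lower #|J|.-1%:R.
Proof.
move=> e0 ball_supp hpl.
have bound j : exists q : R * R, [/\ 0 < q.1, 0 < q.2 &
    {ae (@lebesgue_measure R), forall x, ball p q.1 x -> q.2 <= h j x}].
  have [d [c [d0 c0 hc]]] := power_law_ge (hpl j).
  exists (Num.min d e, c); split => //=; first by rewrite lt_min d0.
  apply: filterS hc => x hx px.
  have := hx (ball_supp j _ _) _; rewrite powRr0 mulr1; apply.
    by apply: le_ball px; rewrite ge_min lexx orbT.
  by apply: le_ball px; rewrite ge_min lexx.
have [q hq] := choice bound.
have [d d0 dq] := @finite_pos_lbound R J (enum J) (fun j => (q j).1)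
  (fun j _ => let: And3 p1 _ _ := hq j in p1).
have dj j : d <= (q j).1 by apply: dq; rewrite mem_enum.
(* This serves twice: for the small balls in the integrand, and with center [p] and radius [d / 2]
   for the domain of integration. *)
have muball j x r : 0 < r -> r + `|x - p| <= d ->
    (((q j).2 * 2 * r)%:E <= mu j (ball x r))%E.
  move=> r0 xr; have [q0 c0 hc] := hq j.
  have := @density_ge _ _ _ (muh j) (ball x r) (q j).2 (measurable_ball _ _) (ltW c0).
  rewrite lebesgue_measure_ball ?(ltW r0)// => H; apply: le_trans (H _).
    by rewrite -EFinM lee_fin le_eqVlt; apply/orP; left; apply/eqP; ring.
  apply: filterS hc => y hy xy; apply: hy; move: xy; rewrite /ball/= => xy.
  have := ler_distD x p y; rewrite (distrC p x) => xpy.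
  by have := dj j; lra.
have b0 j : 0 < (q j).2 * 2 by case: (hq j) => _ c0 _; rewrite mulr_gt0.
pose c0 := (\prod_(j | j != j0) ((q j).2 * 2)) * ((q j0).2 * 2 * (d / 2)).
exists c0.
  apply: mulr_gt0; first by apply: prodr_gt0 => j _; exact: b0.
  by apply: mulr_gt0; [exact: b0|rewrite divr_gt0].
near=> r.
have r0 : 0 < r by near: r; exact: nbhs_right_gt.
have rd : r < d / 2 by near: r; apply: nbhs_right_lt; rewrite divr_gt0.
pose B := \prod_(j | j != j0) ((q j).2 * 2 * r).
have B0 : 0 <= B by apply: prodr_ge0 => j _; rewrite mulr_ge0 ?(ltW (b0 j)) ?(ltW r0).
have mK : measurable (ball p (d / 2) : set (measurableTypeR R)).
  exact: measurable_ball.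
have BK x : ball p (d / 2) x -> (B%:E <= ball_prod j0 mu r x)%E.
  rewrite /ball/= distrC => xp; apply: ball_prod_ge => j.
    by rewrite mulr_ge0 ?(ltW (b0 j)) ?(ltW r0).
  by apply: muball => //; lra.
apply: le_trans (ball_prod_integral_ge mK B0 BK).
apply: (@le_trans _ _ (B%:E * ((q j0).2 * 2 * (d / 2))%:E)%E); last first.
  apply: lee_wpmul2l => //; apply: muball; first by rewrite divr_gt0.
  by rewrite subrr normr0; lra.
rewrite -EFinM lee_fin /B big_split/= prodC1_const powR_mulrn ?(ltW r0)//.
by rewrite /c0 le_eqVlt; apply/orP; left; apply/eqP; ring.
Unshelve. all: by end_near. Qed.

End lower_bound.

(** * Finite unions of closed intervals *)

Section finite_union.
Context {R : realType}.
Variable I : set R.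
Hypothesis hI : finite_union_closed_itv I.

Lemma near_right_notin (S : seq R) (x : R) : \forall y \near x^'+, y \notin S.
Proof.
elim: S => [|s S ih]; first by near=> y.
have xs : \forall y \near x^'+, y != s.
  have [sx|xs] := leP s x.
    near=> y; rewrite gt_eqF//; apply: le_lt_trans sx _.
    by near: y; exact: nbhs_right_gt.
  by near=> y; rewrite lt_eqF//; near: y; exact: nbhs_right_lt.
by near=> y; rewrite inE negb_or; apply/andP; split; near: y.
Unshelve. all: by end_near. Qed.

(** An interior point of one interval can be moved slightly to the right so as to avoid the finite
    list [S]. *)
Lemma finite_union_itv_interior (S : seq R) :
  exists p e, [/\ 0 < e, p \notin S & ball p e `<=` I].
Proof.
case: hI => Js [Js0 JP ->]; case: Js Js0 JP => [//|J Js] _ JP.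
have [_ [x]] := JP J (mem_head _ _).
rewrite /interior/= => /nbhs_ballP[e /= e0 eJ].
have [p [pS [xp pe]]] : exists p, p \notin S /\ x < p /\ p < x + e.
  apply: (@filter_ex _ (x^'+)); near=> p; split; [|split]; near: p.
  - exact: near_right_notin.
  - exact: nbhs_right_gt.
  - by apply: nbhs_right_lt; rewrite ltrDl.
exists p, (x + e - p); split => //; first by rewrite subr_gt0.
move=> y py; exists J; first exact: mem_head.
apply: eJ; move: py; rewrite /ball/= !ltr_norml => /andP[p1 p2].
by apply/andP; split; lra.
Unshelve. all: by end_near. Qed.

(** A nondegenerate interval containing [s] has a second point [y], and convexity gives the segment
    between them. Its side is left open since [s] may be an endpoint. *)
Lemma finite_union_itv_segment (s : R) : I s ->
  exists2 y, y != s & forall x, (s <= x <= y) || (y <= x <= s) -> I x.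
Proof.
case: hI => Js [_ JP ->] [J /= JJs Js_].
have [_ [x]] := JP J JJs.
rewrite /interior/= => /nbhs_ballP[e /= e0 eJ].
have itvJ := @interval_is_interval _ J.
have [y ys Jy] : exists2 y, y != s & [set` J] y.
  have [xs|xs] := eqVneq x s; last by exists x => //; apply: eJ; exact: ballxx.
  exists (x + e / 2); first by rewrite xs -subr_eq0 addrAC subrr add0r; lra.
  by apply: eJ; rewrite /ball/= opprD addrA subrr sub0r normrN gtr0_norm ?divr_gt0//; lra.
exists y => // z /orP[] /andP[z1 z2]; exists J => //.
  by apply: (itvJ s y) => //; apply/andP.
by apply: (itvJ y s) => //; apply/andP.
Qed.

End finite_union.

(** * Logarithms and the limit *)

Lemma near0_ln_lt (R : realType) (M : R) : \forall r \near (0 : R)^'+, ln r < M.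
Proof.
near=> r; have r0 : 0 < r by near: r; exact: nbhs_right_gt.
rewrite -(expRK M) ltr_ln ?posrE ?expR_gt0//.
by near: r; apply: nbhs_right_lt; exact: expR_gt0.
Unshelve. all: by end_near. Qed.

Lemma ln_mul_powR (R : realType) (c r e : R) : 0 < c -> 0 < r ->
  ln (c * r `^ e) = ln c + e * ln r.
Proof. by move=> c0 r0; rewrite lnM ?posrE ?powR_gt0// ln_powR. Qed.

(** As [ln r] tends to minus infinity, the multiplicative constants disappear in the quotient, and
    an arbitrarily small loss in the upper exponent is harmless in the limit. *)
Lemma lne_ratio_cvg (R : realType) (f : R -> \bar R) (e D : R) : 0 < D ->
  (exists2 c, 0 < c & \forall r \near (0 : R)^'+, ((c * r `^ e)%:E <= f r)%E) ->
  (forall eps, 0 < eps -> exists2 C, 0 < C &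
     \forall r \near (0 : R)^'+, (f r <= (C * r `^ (e - eps))%:E)%E) ->
  (lne (f r) / (D * ln r)%:E)%E @[r --> (0 : R)^'+] --> (e / D)%:E.
Proof.
move=> D0 [c c0 hlo] hup.
pose g r := ln (fine (f r)) / (D * ln r).
(* Any one upper bound makes [f r] finite and the lower bound makes it positive, so [lne] reduces to
   the real logarithm. *)
have [C1 C10 hup1] := hup 1 ltr01.
apply: (@cvg_trans _ ((g r)%:E @[r --> (0 : R)^'+])).
  apply: near_eq_cvg; near=> r.
  have r0 : 0 < r by near: r; exact: nbhs_right_gt.
  have lnr : ln r < 0 by near: r; exact: near0_ln_lt.
  have lo : ((c * r `^ e)%:E <= f r)%E by near: r.
  have up : (f r <= (C1 * r `^ (e - 1))%:E)%E by near: r.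
  rewrite /g; case: (f r) lo up => [y| |]//=; rewrite lee_fin => lo _.
  have y0 : 0 < y by apply: lt_le_trans lo; rewrite mulr_gt0// powR_gt0.
  rewrite leNgt y0/= inver mulf_eq0 gt_eqF//= lt_eqF//.
apply: cvg_EFin; first by near=> r.
apply/cvgrPdist_le => eta eta0.
have eps0 : 0 < eta * D / 2 by rewrite divr_gt0// mulr_gt0.
have [C C0 hupe] := hup _ eps0.
(* Half of the tolerance [eta] goes to the loss in the exponent; [- ln r > M] makes the other half
   absorb the logarithms of the constants. *)
pose M := 2 * (`|ln c| + `|ln C| + 1) / (eta * D).
near=> r.
have r0 : 0 < r by near: r; exact: nbhs_right_gt.
have lnM : ln r < - M by near: r; exact: near0_ln_lt.
have lo : ((c * r `^ e)%:E <= f r)%E by near: r.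
have up : (f r <= (C * r `^ (e - eta * D / 2))%:E)%E by near: r.
rewrite /g /=; case: (f r) lo up => [y| |]//=; rewrite !lee_fin => lo up.
have y0 : 0 < y by apply: lt_le_trans lo; rewrite mulr_gt0// powR_gt0.
have {}lo : ln c + e * ln r <= ln y.
  rewrite -ln_mul_powR//.
  by rewrite ler_ln ?posrE// mulr_gt0// powR_gt0.
have {}up : ln y <= ln C + (e - eta * D / 2) * ln r.
  rewrite -ln_mul_powR//.
  by rewrite ler_ln ?posrE// mulr_gt0// powR_gt0.
have M0 : 0 < M.
  by rewrite divr_gt0 ?mulr_gt0// addr_gt0 ?ltr01//; lra.
have ML : eta * D * M = 2 * (`|ln c| + `|ln C| + 1).
  by rewrite /M mulrC divfK// gt_eqF// mulr_gt0.
have EL : eta * D * M < eta * D * (- ln r).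
  by rewrite ltr_pM2l ?mulr_gt0//; lra.
have L0 : 0 < - ln r by lra.
have -> : e / D - ln y / (D * ln r) = (e * (- ln r) + ln y) / (D * (- ln r)).
  have Ln0 : ln r != 0 by rewrite lt_eqF//; lra.
  by field; rewrite Ln0 gt_eqF.
rewrite normrM normfV (gtr0_norm (mulr_gt0 D0 L0)) ler_pdivrMr ?mulr_gt0// mulrA.
have c1 := ler_norm (- ln c); have C1' := ler_norm (ln C).
rewrite normrN in c1.
have ? := normr_ge0 (ln c); have ? := normr_ge0 (ln C).
rewrite ler_norml; apply/andP; split; first by lra.
have X : (e - eta * D / 2) * ln r = e * ln r + (eta * D * - ln r) / 2 by field.
by rewrite X in up; lra.
Unshelve. all: by end_near. Qed.

Section bigmin.
Context {R : realType} (T : eqType) (f : T -> R) (x : R).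

Lemma bigmin_le_mem (l : seq T) s : s \in l -> \big[Num.min/x]_(t <- l) f t <= f s.
Proof.
elim: l => // t l ih; rewrite inE big_cons => /predU1P[->|/ih sl].
  by rewrite ge_min lexx.
by rewrite ge_min sl orbT.
Qed.

Lemma bigmin_attained (l : seq T) :
  \big[Num.min/x]_(t <- l) f t = x \/
  exists2 s, s \in l & \big[Num.min/x]_(t <- l) f t = f s.
Proof.
elim: l => [|t l ih]; first by left; rewrite big_nil.
rewrite big_cons; case: leP => _; first by right; exists t; rewrite ?mem_head.
by case: ih => [->|[s sl ->]]; [left|right; exists s; rewrite // inE sl orbT].
Qed.

End bigmin.

(** * The formula for the co-dimension *)

Lemma codim_integralE (R : realType) (q : nat) (hq : (2 <= q)%N)
  (mu : 'I_q -> probability (measurableTypeR R) R) (r : R) :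
  codim_integral hq mu r =
  (\int[mu (Ordinal (ltnW hq))]_x ball_prod (Ordinal (ltnW hq)) mu r x)%E.
Proof.
apply: eq_integral => x _; apply: eq_bigl => i.
by rewrite -val_eqE/= lt0n.
Qed.

Unset Implicit Arguments.
Set Strict Implicit.
Set Printing Implicit Defensive.

Theorem propositionA1 (R : realType) (q : nat) (hq : (2 <= q)%N)
  (mu : 'I_q -> probability (measurableTypeR R) R) (h : 'I_q -> R -> R)
  (hdens : forall i, is_density (mu i) (h i))
  (I : set R) (hI : I = \bigcap_(i in [set: 'I_q]) supp (mu i))
  (hItv : finite_union_closed_itv I)
  (S : seq R) (hSI : forall s, s \in S -> I s)
  (alpha : 'I_q -> R -> R)
  (halpha : forall i s, I s -> -1 < alpha i s)
  (halpha0 : forall i s, I s -> s \notin S -> alpha i s = 0)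
  (hasymp : forall i s, I s -> power_law_near (mu i) (h i) s (alpha i s))
  (hsing : forall i, no_singularity_off S (h i)) :
  (S = [::] \/ 0 <= alpha_bar alpha S -> is_codim hq mu 1) /\
  (S <> [::] -> alpha_bar alpha S < 0 ->
    is_codim hq mu
      (if q%:R < - (1 / alpha_bar alpha S) then 1
       else q%:R * (1 + alpha_bar alpha S) / (q%:R - 1))).
Proof.
set i0 : 'I_q := Ordinal (ltnW hq).
have Isupp x j : I x -> supp (mu j) x by rewrite hI => /(_ j); exact.
have q1E : #|'I_q|.-1%:R = q%:R - 1 :> R.
  by rewrite card_ord -subn1 natrB// ltnW.
have q10 : 0 < q%:R - 1 :> R by rewrite subr_gt0 ltr1n.
have q0 : 0 < q%:R :> R by lra.
(* For such [e] the upper bound of exponent [e - eps] always holds, [eps] making the inequalities at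
   [S] strict; what remains in each case is a matching lower bound. *)
have codim_from_lower e : e <= q%:R - 1 ->
    (forall s, s \in S -> e <= q%:R + \sum_i alpha i s) ->
    ball_prod_lower i0 mu e -> is_codim hq mu (e / (q%:R - 1)).
  move=> e1 e2 elow; rewrite /is_codim.
  apply: lne_ratio_cvg => //.
    case: elow => c c0 hc; exists c => //.
    by apply: filterS hc => r; rewrite codim_integralE.
  move=> eps eps0.
  have [|||||C C0 hC] := @ball_prod_upper_global _ _ i0 mu h hdens S alpha (e - eps).
  - by move=> j s /hSI; exact: halpha.
  - by move=> j s /hSI; exact: hasymp.
  - exact: hsing.
  - by rewrite q1E; lra.
  - by move=> s /e2 es; rewrite q1E; lra.
  exists C => //.
  by apply: filterS hC => r; rewrite codim_integralE.
have low_regular : ball_prod_lower i0 mu (q%:R - 1).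
  have [p [d [d0 pS pI]]] := finite_union_itv_interior hItv S.
  have Ip : I p by apply: pI; exact: ballxx.
  rewrite -q1E; apply: (ball_prod_lower_regular i0 hdens d0).
    by move=> j x /pI; exact: Isupp.
  by move=> j; rewrite -(halpha0 j p Ip pS); exact: hasymp.
have low_singular s : I s -> ball_prod_lower i0 mu (q%:R + \sum_i alpha i s).
  move=> Is; have [y ys sy] := finite_union_itv_segment hItv Is.
  have -> : q%:R + \sum_i alpha i s = #|'I_q|.-1%:R + 1 + \sum_i alpha i s.
    by rewrite q1E subrK.
  have hpl i := hasymp i s Is.
  (* On the available side of [s], [lo] selects the points at distance between [r / 4] and
     [r / 2]. *)
  move: ys; rewrite neq_lt => /orP[ys|sy'].
  - apply: (ball_prod_lower_singular i0 hdens (lo := fun r => s - r / 2) hpl).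
    near=> r.
    have r0 : 0 < r by near: r; exact: nbhs_right_gt.
    have rs : r < s - y by near: r; apply: nbhs_right_lt; rewrite subr_gt0.
    move=> x /andP[x1 x2]; split; last first.
      by move=> j; apply/Isupp/sy; apply/orP; right; apply/andP; split; lra.
    by rewrite ltr0_norm; [apply/andP; split|]; lra.
  - apply: (ball_prod_lower_singular i0 hdens (lo := fun r => s + r / 4) hpl).
    near=> r.
    have r0 : 0 < r by near: r; exact: nbhs_right_gt.
    have rs : r < y - s by near: r; apply: nbhs_right_lt; rewrite subr_gt0.
    move=> x /andP[x1 x2]; split; last first.
      by move=> j; apply/Isupp/sy; apply/orP; left; apply/andP; split; lra.
    by rewrite gtr0_norm; [apply/andP; split|]; lra.
have sumE s : \sum_i alpha i s = q%:R * alpha_mean alpha s.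
  by rewrite /alpha_mean mulrA divff ?mul1r// gt_eqF.
have bar_le s : s \in S -> alpha_bar alpha S <= alpha_mean alpha s.
  exact: bigmin_le_mem.
(* Here no exponent [q + A s] is below [q - 1], so the regular points dictate [e = q - 1]. *)
have codim1 : (forall s, s \in S -> -1 <= q%:R * alpha_mean alpha s) ->
    is_codim hq mu 1.
  move=> hs; rewrite -(divff (lt0r_neq0 q10)); apply: codim_from_lower => //.
  by move=> s /hs; rewrite sumE; lra.
split.
  move=> Sbar; apply: codim1 => s sS; apply: (@le_trans _ _ 0) => //.
  rewrite mulr_ge0 ?(ltW q0)//; apply: le_trans (bar_le _ sS).
  by case: Sbar => // S0; rewrite S0 in sS.
move=> S0 bar0.
(* Multiplying by the positive number [- alpha_bar alpha S] turns the threshold on [q] into the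
   comparison of [q - 1] with the least [q + A s]. *)
have barE : (q%:R < - (1 / alpha_bar alpha S)) = (-1 < q%:R * alpha_bar alpha S).
  by rewrite -mulrN -invrN div1r -[X in _ < X]mul1r ltr_pdivlMr ?oppr_gt0// mulrN ltrNl.
case: ifPn => [|]; rewrite barE.
  move=> hq1; apply: codim1 => s sS; apply: le_trans (ltW hq1) _.
  by rewrite ler_pM2l// bar_le.
rewrite -leNgt => hq1.
have [s sS sE] : exists2 s, s \in S & alpha_bar alpha S = alpha_mean alpha s.
  (* The seed is itself the value at the head of [S], a member because [S] is not empty. *)
  have [E|//] := bigmin_attained (alpha_mean alpha) (alpha_mean alpha (head 0 S)) S.
  exists (head 0 S) => //; rewrite -nth0; apply: mem_nth.
  by case: (S) S0.
(* The exponent is [e = q * (1 + alpha_bar alpha S)], the value of [q + A s] at a minimising [s],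
   whose neighbourhood gives the lower bound. *)
apply: codim_from_lower.
- by rewrite mulrDr mulr1; lra.
- move=> t tS; rewrite mulrDr mulr1 lerD2l sumE ler_pM2l//; exact: bar_le.
- by rewrite mulrDr mulr1 sE -sumE; apply: low_singular; exact: hSI.
Unshelve. all: by end_near. Qed.
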